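(* Let $E$ be an edge of $G$ with initial vertex $V_1$ and terminal vertex $V_2$, where $V_1$ is a periodic point of $f$ with period $m$ and $V_2$ is a periodic point of $f$ with period $n$, and $E$ belongs to the spanning tree used for the coherent labeling. Let $w\in\pi$ and suppose that $E$ belongs to $w$. If $\rho(V_1)=w^{k_1/m}$ and $\rho(V_2)=w^{k_2/n}$ for integers $k_1,k_2$ (that is, $\widetilde f^m(\widetilde V_1)=w^{k_1}\widetilde V_1$ and $\widetilde f^n(\widetilde V_2)=w^{k_2}\widetilde V_2$), then for any rational number $r$ that lies strictly between $k_1/m$ and $k_2/n$ there exist integers $p$ and $q$ with $p/q=r$ and a periodic point $x\in E$ of $f$ with $\rho(x)=(w^p\gamma)^{1/q}$, where $\gamma$ is an initial word of $w$.
   Context: $G$ is a finite connected directed graph (multiple edges allowed, no looped edges) with base vertex $x_0$; $\pi=\pi_1(G,x_0)$, a free group; $\widetilde G$ is the universal cover of $G$, a tree. Elements of $\pi$ are identified with covering transformations of $\widetilde G$ (after fixing a lift $\widetilde x_0$ of $x_0$, the lift at $\widetilde x_0$ of a loop in class $\gamma$ ends at $\gamma\widetilde x_0$), and products act by $(\alpha\beta)\widetilde x=\alpha(\beta\widetilde x)$. Coherent labeling: choose a spanning tree $\mathcal T$ of $G$ rooted at $x_0$ and lift it to a tree in $\widetilde G$ through $\widetilde x_0$; this defines the chosen lifts $\widetilde V$ of all vertices and $\widetilde E$ of all edges of $\mathcal T$. For an edge $E\notin\mathcal T$ with initial vertex $V$ and terminal vertex $V'$, $\widetilde E$ is the lift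 of $E$ starting at $\widetilde V$; it ends at $\theta\widetilde V'$, where $\theta\in\pi$ is the class of the loop formed by $E$ and $\mathcal T$. These $\theta$ are free generators of $\pi$; words, and initial words (possibly empty initial subwords of the reduced word), are with respect to these generators. For $x$ in the interior of an edge $E$, $\widetilde x$ is the point of $\widetilde E$ over $x$; for a vertex, $\widetilde x$ is its chosen lift. The labeling is coherent with $E\in\mathcal T$, so $\widetilde E$ goes from $\widetilde V_1$ to $\widetilde V_2$. $f:G\to G$ is a continuous vertex map (it permutes the vertices of $G$) homotopic to the identity, and $\widetilde f$ is a fixed lift with $\widetilde f(\gamma\widetilde x)=\gamma\widetilde f(\widetilde x)$ for all $\gamma\in\pi$. Rotation element: for $x\in\mathrm{Fix}(f^n)$, let $w\in\pi$ satisfy $\widetilde f^n(\widetilde x)=w\widetilde x$; then $\rho(x)=w^{1/n}$. Rational powers are formal, modulo $(w^k)^r=w^{kr}$ for integers $k$ and rationals $r$ (equivalently they lie in the free $\mathbb Q$-group, where $w^{1/n}=v^{1/m}$ iff $w^m=v^n$). Belonging: an edge loop in $G$ is cyclically reduced when its first edge is not the reverse of its last edge (and it has no backtracking). Every loop can be contracted onto a cyclically reduced loop by changing the base point to another vertex of the loop and canceling adjacent inverse edges; the result is called a cyclic reduction. An edge $E$ belongs to $\alpha\in\pi$ when every cyclic reduction of $\alpha$ uses $E$ or $E^{-1}$. *)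

(* Defs.v *)
From HB Require Import structures.
From mathcomp Require Import all_boot all_order all_algebra.
From mathcomp Require Import all_classical all_reals all_analysis.
Import Order.TTheory GRing.Theory Num.Theory.
Import numFieldNormedType.Exports.

Set Implicit Arguments.
Unset Strict Implicit.
Unset Printing Implicit Defensive.

Local Open Scope classical_set_scope.
Local Open Scope ring_scope.

(* Vertex and edge types are arbitrary, since the universal cover of a finite
   graph is usually infinite. Multiple edges are allowed. *)
Record digraph := Digraph {
  vert : choiceType;
  edge : choiceType;
  src : edge -> vert;
  tgt : edge -> vert
}.

(* [(e, true)] is the edge [e], [(e, false)] is its reverse. *)
Definition oedge (G : digraph) : Type := (edge G * bool)%type.
HB.instance Definition _ (G : digraph) := Choice.on (oedge G).

Definition ostart (G : digraph) (a : oedge G) : vert G :=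
  if a.2 then src a.1 else tgt a.1.

Definition oend (G : digraph) (a : oedge G) : vert G :=
  if a.2 then tgt a.1 else src a.1.

Definition oinv (G : digraph) (a : oedge G) : oedge G := (a.1, ~~ a.2).

Fixpoint walk (G : digraph) (u : vert G) (l : seq (oedge G)) : bool :=
  if l is a :: l' then (ostart a == u) && walk (oend a) l' else true.

Fixpoint wend (G : digraph) (u : vert G) (l : seq (oedge G)) : vert G :=
  if l is a :: l' then wend (oend a) l' else u.

Definition wfrom_to (G : digraph) (u v : vert G) (l : seq (oedge G)) : bool :=
  walk u l && (wend u l == v).

Definition wrev (G : digraph) (l : seq (oedge G)) : seq (oedge G) :=
  rev (map (@oinv G) l).

Definition connected_graph (G : digraph) : Prop :=
  forall u v : vert G, exists l, wfrom_to u v l.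

(* no backtracking *)
Definition reduced (G : digraph) (l : seq (oedge G)) : bool :=
  sorted (fun a b => b != oinv a) l.

(* [cycle] also compares the last letter with the first one. *)
Definition cyclically_reduced (G : digraph) (l : seq (oedge G)) : bool :=
  cycle (fun a b => b != oinv a) l.

Definition push (G : digraph) (a : oedge G) (s : seq (oedge G)) : seq (oedge G) :=
  if s is b :: s' then if b == oinv a then s' else a :: s else [:: a].

(* The unique reduced edge path homotopic to [l] relative to its end points. *)
Definition reduce (G : digraph) (l : seq (oedge G)) : seq (oedge G) :=
  foldr (@push G) [::] l.

Lemma oinvK (G : digraph) : involutive (@oinv G).
Proof. by case=> e b; rewrite /oinv /= negbK. Qed.

Lemma ostart_inv (G : digraph) (a : oedge G) : ostart (oinv a) = oend a.
Proof. by case: a => e []. Qed.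

Lemma oend_inv (G : digraph) (a : oedge G) : oend (oinv a) = ostart a.
Proof. by case: a => e []. Qed.

Lemma walk_cat (G : digraph) (u : vert G) l1 l2 :
  walk u (l1 ++ l2) = walk u l1 && walk (wend u l1) l2.
Proof. by elim: l1 u => //= a l1 IH u; rewrite IH andbA. Qed.

Lemma wend_cat (G : digraph) (u : vert G) l1 l2 :
  wend u (l1 ++ l2) = wend (wend u l1) l2.
Proof. by elim: l1 u => //= a l1 IH u; rewrite IH. Qed.

Lemma wfrom_to_cat (G : digraph) (u v w : vert G) l1 l2 :
  wfrom_to u v l1 -> wfrom_to v w l2 -> wfrom_to u w (l1 ++ l2).
Proof.
move=> /andP[w1 /eqP e1] /andP[w2 e2].
by rewrite /wfrom_to walk_cat wend_cat e1 w1 w2.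
Qed.

Lemma wfrom_to_rev (G : digraph) (u v : vert G) l :
  wfrom_to u v l -> wfrom_to v u (wrev l).
Proof.
rewrite /wrev; elim: l u => [|a l IH] u.
  by rewrite /wfrom_to /= eq_sym.
rewrite /wfrom_to /= -andbA => /andP[/eqP <- /IH h].
rewrite rev_cons -cats1; apply: wfrom_to_cat h _.
by rewrite /wfrom_to /= ostart_inv oend_inv !eqxx.
Qed.

Lemma wfrom_to_push (G : digraph) (u v : vert G) a s :
  wfrom_to u v (a :: s) -> wfrom_to u v (push a s).
Proof.
case: s => [//|b s] /=; case: eqP => [->|//].
by rewrite /wfrom_to /= ostart_inv oend_inv -!andbA => /and4P[/eqP-> _ -> ->].
Qed.

Lemma wfrom_to_reduce (G : digraph) (u v : vert G) l :
  wfrom_to u v l -> wfrom_to u v (reduce l).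
Proof.
elim: l u => [//|a l IH] u; rewrite /wfrom_to /= -andbA => /andP[h1 /IH h2].
by apply: wfrom_to_push; move: h2; rewrite /wfrom_to /= -andbA h1.
Qed.

Lemma reduced_cons (G : digraph) (a : oedge G) s : reduced (a :: s) -> reduced s.
Proof. by rewrite /reduced; exact: path_sorted. Qed.

Lemma reduced_push (G : digraph) (a : oedge G) s :
  reduced s -> reduced (push a s).
Proof.
case: s => [//|b s] rs /=; case: eqP => [_|/eqP ab]; first exact: reduced_cons rs.
by rewrite /reduced /= ab.
Qed.

Lemma reduced_foldr (G : digraph) (s l : seq (oedge G)) :
  reduced s -> reduced (foldr (@push G) s l).
Proof. by move=> rs; elim: l => //= a l; exact: reduced_push. Qed.

Lemma reduce_reduced (G : digraph) (l : seq (oedge G)) : reduced (reduce l).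
Proof. exact: reduced_foldr. Qed.

Lemma reduce_id (G : digraph) (l : seq (oedge G)) : reduced l -> reduce l = l.
Proof.
elim: l => //= a l IH rl; rewrite IH ?(reduced_cons rl)//.
by case: l rl {IH} => //= b l /andP[/negbTE -> _].
Qed.

Lemma push_pushV (G : digraph) (a : oedge G) s :
  reduced s -> push a (push (oinv a) s) = s.
Proof.
case: s => [|b s] /=; first by rewrite eqxx.
rewrite oinvK; case: eqP => [-> {b}|_ _]; last by rewrite /= eqxx.
by case: s => //= b s /andP[/negbTE -> _].
Qed.

Lemma foldr_reduce (G : digraph) (s l : seq (oedge G)) : reduced s ->
  foldr (@push G) s (reduce l) = foldr (@push G) s l.
Proof.
move=> rs; elim: l => //= a l <-.
case: (reduce l) => //= b r; case: eqP => //= ->.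
by rewrite push_pushV//; exact: reduced_foldr.
Qed.

Lemma reduce_cat (G : digraph) (l1 l2 : seq (oedge G)) :
  reduce (l1 ++ l2) = foldr (@push G) (reduce l2) l1.
Proof. by rewrite /reduce foldr_cat. Qed.

Lemma reduce_catl (G : digraph) (l1 l2 : seq (oedge G)) :
  reduce (reduce l1 ++ l2) = reduce (l1 ++ l2).
Proof. by rewrite !reduce_cat foldr_reduce// reduce_reduced. Qed.

Lemma reduce_catr (G : digraph) (l1 l2 : seq (oedge G)) :
  reduce (l1 ++ reduce l2) = reduce (l1 ++ l2).
Proof. by rewrite !reduce_cat (reduce_id (reduce_reduced _)). Qed.

Lemma wrevK (G : digraph) : involutive (@wrev G).
Proof.
by move=> l; rewrite /wrev map_rev revK -map_comp map_id_in// => a _ /=; rewrite oinvK.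
Qed.

Lemma reduce_wrevr (G : digraph) (l : seq (oedge G)) :
  reduce (l ++ wrev l) = [::].
Proof.
elim: l => // a l IH.
rewrite /wrev map_cons rev_cons -cats1 -/(wrev l) cat_cons catA.
rewrite -[reduce _]/(push a (reduce ((l ++ wrev l) ++ [:: oinv a]))).
by rewrite -reduce_catl IH /= eqxx.
Qed.

Lemma reduce_wrevl (G : digraph) (l : seq (oedge G)) :
  reduce (wrev l ++ l) = [::].
Proof. by rewrite -{2}(wrevK l) reduce_wrevr. Qed.

Lemma all_reduce (G : digraph) (P : pred (edge G)) (l : seq (oedge G)) :
  all (fun a => P a.1) l -> all (fun a => P a.1) (reduce l).
Proof.
elim: l => //= a l IH /andP[Pa /IH]; case: (reduce l) => [|b r] /=.
  by rewrite Pa.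
by case: eqP => _ /= /andP[Pb Pr]; rewrite ?Pa ?Pb Pr.
Qed.

(* A homotopy class of loops at [x0] is represented by its unique reduced
   closed edge path. *)
Record pi1 (G : digraph) (x0 : vert G) := Pi1 {
  pi1_path : seq (oedge G);
  _ : wfrom_to x0 x0 pi1_path && reduced pi1_path
}.

HB.instance Definition _ (G : digraph) (x0 : vert G) :=
  [isSub for @pi1_path G x0].
HB.instance Definition _ (G : digraph) (x0 : vert G) :=
  [Choice of pi1 x0 by <:].

Definition loop_class (G : digraph) (x0 : vert G) (l : seq (oedge G))
    (hl : wfrom_to x0 x0 l) : pi1 x0 :=
  @Pi1 G x0 (reduce l)
    (introT andP (conj (wfrom_to_reduce hl) (reduce_reduced l))).

Lemma pi1_loop (G : digraph) (x0 : vert G) (g : pi1 x0) :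
  wfrom_to x0 x0 (pi1_path g).
Proof. by case: g => l /= /andP[]. Qed.

Lemma pi1_reduced (G : digraph) (x0 : vert G) (g : pi1 x0) :
  reduced (pi1_path g).
Proof. by case: g => l /= /andP[]. Qed.

Definition pi1_mul (G : digraph) (x0 : vert G) (a b : pi1 x0) : pi1 x0 :=
  loop_class (wfrom_to_cat (pi1_loop a) (pi1_loop b)).

Lemma wfrom_to_nil (G : digraph) (u : vert G) : wfrom_to u u [::].
Proof. by rewrite /wfrom_to /= eqxx. Qed.

Definition pi1_one (G : digraph) (x0 : vert G) : pi1 x0 :=
  loop_class (wfrom_to_nil x0).

Definition pi1_inv (G : digraph) (x0 : vert G) (a : pi1 x0) : pi1 x0 :=
  loop_class (wfrom_to_rev (pi1_loop a)).

Lemma pi1_mulA (G : digraph) (x0 : vert G) : associative (@pi1_mul G x0).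
Proof. by move=> a b c; apply: val_inj; rewrite /= reduce_catl reduce_catr catA. Qed.

Lemma pi1_mul1g (G : digraph) (x0 : vert G) :
  left_id (pi1_one x0) (@pi1_mul G x0).
Proof. by move=> a; apply: val_inj; rewrite /= reduce_id// pi1_reduced. Qed.

Lemma pi1_mulg1 (G : digraph) (x0 : vert G) :
  right_id (pi1_one x0) (@pi1_mul G x0).
Proof. by move=> a; apply: val_inj; rewrite /= cats0 reduce_id// pi1_reduced. Qed.

Lemma pi1_mulVg (G : digraph) (x0 : vert G) :
  left_inverse (pi1_one x0) (@pi1_inv G x0) (@pi1_mul G x0).
Proof. by move=> a; apply: val_inj; rewrite /= reduce_catl reduce_wrevl. Qed.

Lemma pi1_mulgV (G : digraph) (x0 : vert G) :
  right_inverse (pi1_one x0) (@pi1_inv G x0) (@pi1_mul G x0).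
Proof. by move=> a; apply: val_inj; rewrite /= reduce_catr reduce_wrevr. Qed.

HB.instance Definition _ (G : digraph) (x0 : vert G) :=
  isGroup.Build (pi1 x0) (@pi1_mulA G x0) (@pi1_mul1g G x0) (@pi1_mulg1 G x0)
    (@pi1_mulVg G x0) (@pi1_mulgV G x0).

(* A vertex of the universal cover is a homotopy class of edge paths starting
   at [x0], represented by its reduced path. *)
Record cvert (G : digraph) (x0 : vert G) := CVert {
  cpath : seq (oedge G);
  _ : walk x0 cpath && reduced cpath
}.

HB.instance Definition _ (G : digraph) (x0 : vert G) :=
  [isSub for @cpath G x0].
HB.instance Definition _ (G : digraph) (x0 : vert G) :=
  [Choice of cvert x0 by <:].

Definition cend (G : digraph) (x0 : vert G) (v : cvert x0) : vert G :=
  wend x0 (cpath v).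

Lemma cvert_path (G : digraph) (x0 : vert G) (v : cvert x0) :
  wfrom_to x0 (cend v) (cpath v).
Proof. by rewrite /wfrom_to /cend eqxx andbT; case: v => l /= /andP[]. Qed.

Lemma cvert_of_subproof (G : digraph) (x0 u : vert G) (l : seq (oedge G)) :
  wfrom_to x0 u l -> walk x0 (reduce l) && reduced (reduce l).
Proof.
by move=> /wfrom_to_reduce /andP[-> _]; rewrite reduce_reduced.
Qed.

Definition cvert_of (G : digraph) (x0 u : vert G) (l : seq (oedge G))
    (hl : wfrom_to x0 u l) : cvert x0 :=
  CVert (cvert_of_subproof hl).

Lemma cend_cvert_of (G : digraph) (x0 u : vert G) (l : seq (oedge G))
    (hl : wfrom_to x0 u l) : cend (cvert_of hl) = u.
Proof. by have /andP[_ /eqP] := wfrom_to_reduce hl. Qed.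

(* [(v, e)] is the lift of the edge [e] starting at [v]. *)
Definition cedge (G : digraph) (x0 : vert G) : Type :=
  {p : cvert x0 * edge G | cend p.1 == src p.2}.
HB.instance Definition _ (G : digraph) (x0 : vert G) := Choice.on (cedge x0).

Definition csrc (G : digraph) (x0 : vert G) (e : cedge x0) : cvert x0 :=
  (val e).1.

Lemma ctgt_subproof (G : digraph) (x0 : vert G) (e : cedge x0) :
  wfrom_to x0 (tgt (val e).2) (cpath (val e).1 ++ [:: ((val e).2, true)]).
Proof.
case: e => [[v e] /= ve]; apply: wfrom_to_cat (cvert_path v) _.
by rewrite /wfrom_to /ostart /oend /= eq_sym ve eqxx.
Qed.

Definition ctgt (G : digraph) (x0 : vert G) (e : cedge x0) : cvert x0 :=
  cvert_of (ctgt_subproof e).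

Definition ucover (G : digraph) (x0 : vert G) : digraph :=
  Digraph (@csrc G x0) (@ctgt G x0).

Definition deck_vert (G : digraph) (x0 : vert G) (g : pi1 x0) (v : cvert x0) :
    cvert x0 :=
  cvert_of (wfrom_to_cat (pi1_loop g) (cvert_path v)).

Lemma deck_edge_subproof (G : digraph) (x0 : vert G) (g : pi1 x0) (e : cedge x0) :
  cend (deck_vert g (val e).1) == src (val e).2.
Proof. by rewrite cend_cvert_of; exact: (valP e). Qed.

Definition deck_edge (G : digraph) (x0 : vert G) (g : pi1 x0) (e : cedge x0) :
    cedge x0 :=
  exist _ (deck_vert g (val e).1, (val e).2) (deck_edge_subproof g e).

Inductive gpoint (R : realType) (G : digraph) : Type :=
| GVert of vert G
| GEdge of edge G & {t : R | 0 < t < 1}.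
Arguments GVert {R G} _.
Arguments GEdge {R G} _ _.

HB.instance Definition _ (R : realType) (G : digraph) :=
  gen_eqMixin (gpoint R G).
HB.instance Definition _ (R : realType) (G : digraph) :=
  gen_choiceMixin (gpoint R G).

(* The characteristic map of the edge [e], precomposed with the retraction of
   the real line onto [0, 1]. *)
Definition charmap (R : realType) (G : digraph) (e : edge G) (t : R) :
    gpoint R G :=
  if insub t is Some t' then GEdge e t'
  else if t <= 0 then GVert (src e) else GVert (tgt e).

(* CW topology. As [charmap] factors through the retraction onto [0, 1], the
   preimage below is open in the line iff its trace is open in [0, 1]. *)
Definition gopen (R : realType) (G : digraph) : set_system (gpoint R G) :=
  [set U | forall e : edge G, open (charmap e @^-1` U : set R)].

Lemma gopenT (R : realType) (G : digraph) : gopen [set: gpoint R G].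
Proof. by move=> e; rewrite preimage_setT; exact: openT. Qed.

Lemma gopenI (R : realType) (G : digraph) : setI_closed (@gopen R G).
Proof. by move=> A B oA oB e; rewrite preimage_setI; exact: openI. Qed.

Lemma gopen_bigU (R : realType) (G : digraph) (I : Type)
    (U : I -> set (gpoint R G)) :
  (forall i, gopen (U i)) -> gopen (\bigcup_i U i).
Proof.
by move=> oU e; rewrite preimage_bigcup; apply: bigcup_open => i _; exact: oU.
Qed.

HB.instance Definition _ (R : realType) (G : digraph) :=
  isOpenTopological.Build (gpoint R G) (@gopenT R G) (@gopenI R G)
    (@gopen_bigU R G).

Definition closed_edge (R : realType) (G : digraph) (e : edge G) :
    set (gpoint R G) :=
  [set charmap e t | t in `[0, 1]].

Definition cover_proj (R : realType) (G : digraph) (x0 : vert G)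
    (y : gpoint R (ucover x0)) : gpoint R G :=
  match y with
  | GVert v => GVert (cend (v : cvert x0))
  | GEdge e t => GEdge (val (e : cedge x0)).2 t
  end.

Definition deck (R : realType) (G : digraph) (x0 : vert G) (g : pi1 x0)
    (y : gpoint R (ucover x0)) : gpoint R (ucover x0) :=
  match y with
  | GVert v => @GVert R (ucover x0) (deck_vert g v)
  | GEdge e t => @GEdge R (ucover x0) (deck_edge g e) t
  end.

Record spanning_tree (G : digraph) := SpanningTree {
  tree_edge : {pred edge G};
  tree_connected : forall u v : vert G, exists l,
    wfrom_to u v l && all (fun a => a.1 \in tree_edge) l;
  tree_acyclic : forall (u : vert G) l,
    wfrom_to u u l -> reduced l -> all (fun a => a.1 \in tree_edge) l -> l = [::]
}.

Lemma tree_lift_subproof (G : digraph) (x0 : vert G) (T : spanning_tree G)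
    (v : vert G) : exists y : cvert x0,
  (cend y == v) && all (fun a => a.1 \in tree_edge T) (cpath y).
Proof.
have [l /andP[hl Tl]] := tree_connected T x0 v.
by exists (cvert_of hl); rewrite cend_cvert_of eqxx /= all_reduce.
Qed.

(* The end point of the lift, starting at the class of the constant path, of
   the unique reduced path in [T] from [x0] to [v]. *)
Definition lift_vert (G : digraph) (x0 : vert G) (T : spanning_tree G)
    (v : vert G) : cvert x0 :=
  xchoose (tree_lift_subproof x0 T v).

Lemma cend_lift_vert (G : digraph) (x0 : vert G) (T : spanning_tree G)
    (v : vert G) : cend (lift_vert x0 T v) = v.
Proof. by have /andP[/eqP] := xchooseP (tree_lift_subproof x0 T v). Qed.

(* The lift of [e] starting at the chosen lift of its initial vertex; when [e]
   is in [T], this is also the edge over [e] of the lifted tree. *)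
Definition lift_edge (G : digraph) (x0 : vert G) (T : spanning_tree G)
    (e : edge G) : cedge x0 :=
  exist _ (lift_vert x0 T (src e), e)
    (introT eqP (cend_lift_vert x0 T (src e))).

Definition lift_point (R : realType) (G : digraph) (x0 : vert G)
    (T : spanning_tree G) (x : gpoint R G) : gpoint R (ucover x0) :=
  match x with
  | GVert v => @GVert R (ucover x0) (lift_vert x0 T v)
  | GEdge e t => @GEdge R (ucover x0) (lift_edge x0 T e) t
  end.

Lemma theta_subproof (G : digraph) (x0 : vert G) (T : spanning_tree G)
    (e : edge G) :
  wfrom_to x0 x0 (cpath (lift_vert x0 T (src e)) ++
    [:: (e, true)] ++ wrev (cpath (lift_vert x0 T (tgt e)))).
Proof.
have h v : wfrom_to x0 v (cpath (lift_vert x0 T v)).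
  by have := cvert_path (lift_vert x0 T v); rewrite cend_lift_vert.
apply: wfrom_to_cat (h _) _; apply: wfrom_to_cat (wfrom_to_rev (h _)).
by rewrite /wfrom_to /ostart /oend /= !eqxx.
Qed.

Definition theta (G : digraph) (x0 : vert G) (T : spanning_tree G)
    (e : edge G) : pi1 x0 :=
  loop_class (theta_subproof x0 T e).

(* A word in the generators [theta e], for [e] not in [T], is a sequence of
   pairs [(e, b)] which stand for [theta e] or its inverse. *)
Definition word_eval (G : digraph) (x0 : vert G) (T : spanning_tree G)
    (u : seq (oedge G)) : pi1 x0 :=
  (\prod_(a <- u) (if a.2 then theta x0 T a.1 else (theta x0 T a.1)^-1))%g.

Definition reduced_word_of (G : digraph) (x0 : vert G) (T : spanning_tree G)
    (u : seq (oedge G)) (w : pi1 x0) : Prop :=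
  [/\ all (fun a => a.1 \notin tree_edge T) u, reduced u
    & word_eval x0 T u = w].

Definition initial_word (G : digraph) (x0 : vert G) (T : spanning_tree G)
    (g w : pi1 x0) : Prop :=
  exists u1 u2, reduced_word_of T (u1 ++ u2) w /\ word_eval x0 T u1 = g.

Definition homotopic (R : realType) (X Y : topologicalType) (f g : X -> Y) :
    Prop :=
  exists H : X * R -> Y,
    [/\ {within [set z | z.2 \in `[0, 1]], continuous H},
        forall x, H (x, 0) = f x & forall x, H (x, 1) = g x].

Definition permutes_vertices (R : realType) (G : digraph)
    (f : gpoint R G -> gpoint R G) : Prop :=
  exists2 s : vert G -> vert G,
    bijective s & forall v, f (GVert v) = GVert (s v).

Definition equivariant_lift (R : realType) (G : digraph) (x0 : vert G)
    (f : gpoint R G -> gpoint R G)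
    (ft : gpoint R (ucover x0) -> gpoint R (ucover x0)) : Prop :=
  [/\ continuous ft, forall y, cover_proj (ft y) = f (cover_proj y)
    & forall g y, ft (deck g y) = deck g (ft y)].

Definition periodic_point (X : Type) (f : X -> X) (n : nat) (x : X) : Prop :=
  (0 < n)%N /\ iter n f x = x.

Definition expgz (gT : groupType) (g : gT) (k : int) : gT :=
  match k with Posz n => (g ^+ n)%g | Negz n => (g ^- n.+1)%g end.

(* Equality of the formal rational powers [g ^ r] and [h ^ s], for [gT] free:
   both are raised to the power [denq r * denq s], which loses nothing since
   roots are unique in the free Q-group. *)
Definition qpow_eq (gT : groupType) (g : gT) (r : rat) (h : gT) (s : rat) :
    Prop :=
  expgz g (numq r * denq s) = expgz h (numq s * denq r).

(* The rotation element of the periodic point [x], which is [w ^ (1 / n)] for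
   any [n] and [w] as below, equals [g ^ r]. *)
Definition rotation_eq (R : realType) (G : digraph) (x0 : vert G)
    (T : spanning_tree G) (f : gpoint R G -> gpoint R G)
    (ft : gpoint R (ucover x0) -> gpoint R (ucover x0)) (x : gpoint R G)
    (g : pi1 x0) (r : rat) : Prop :=
  exists n (w : pi1 x0),
    [/\ periodic_point f n x,
        iter n ft (lift_point x0 T x) = deck w (lift_point x0 T x)
      & qpow_eq w (n%:Q)^-1 g r].

(* [contracts l c]: the closed edge path [l] can be turned into [c] by changes
   of base point along the path and cancellations of adjacent inverse edges. *)
Inductive contracts (G : digraph) : seq (oedge G) -> seq (oedge G) -> Prop :=
| contracts_refl l : contracts l l
| contracts_rot l1 l2 c : contracts (l2 ++ l1) c -> contracts (l1 ++ l2) c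
| contracts_cancel l1 a l2 c :
    contracts (l1 ++ l2) c -> contracts (l1 ++ [:: a; oinv a] ++ l2) c.

Definition cyclic_reduction (G : digraph) (x0 : vert G) (g : pi1 x0)
    (c : seq (oedge G)) : Prop :=
  exists l (hl : wfrom_to x0 x0 l),
    [/\ loop_class hl = g, contracts l c & cyclically_reduced c].

Definition belongs (G : digraph) (x0 : vert G) (e : edge G) (g : pi1 x0) :
    Prop :=
  forall c, cyclic_reduction g c -> ((e, true) \in c) || ((e, false) \in c).

(* Main.v *)
(* Raise [f] to a power [N] such that the lift [ft ^ N] moves the end points of
   the chosen lift of [E] by [w ^ a] and [w ^ b] while [r * N = p] is an integer
   far from both [a] and [b]. Since [E] occurs in the cyclically reduced form of
   [w], the axis of [w] in the tree contains a lift [g E] of [E]; as [E] is in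
   the spanning tree, [g] is an initial word of [w]. So [w ^ p g E] separates
   the two image points, and [ft ^ N] carries the lift of [E] across it. Compare
   the projection of the tree onto that edge with the parameter of [E]: by the
   intermediate value theorem some interior point of [E] is sent to the point
   of [w ^ p g E] with the same parameter. *)

Require Import Defs.
From HB Require Import structures.
From mathcomp Require Import all_boot all_order all_algebra.
From mathcomp Require Import ring lra zify.
From mathcomp Require Import all_classical all_reals all_analysis.
Import Order.TTheory GRing.Theory Num.Theory.
Import numFieldNormedType.Exports.

Set Implicit Arguments.
Unset Strict Implicit.
Unset Printing Implicit Defensive.

Local Open Scope classical_set_scope.
Local Open Scope ring_scope.

(* Otherwise [oinv] would be the partial inverse of mathcomp-classical. *)
Local Notation oinv := (@Defs.oinv _).

(** * Free reduction of edge paths *)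

Lemma wrev_cons (G : digraph) (a : oedge G) l :
  wrev (a :: l) = rcons (wrev l) (oinv a).
Proof. by rewrite /wrev /= rev_cons. Qed.

Lemma wrev_cat (G : digraph) (l1 l2 : seq (oedge G)) :
  wrev (l1 ++ l2) = wrev l2 ++ wrev l1.
Proof. by rewrite /wrev map_cat rev_cat. Qed.

Lemma reduce_congr (G : digraph) (l1 l1' l2 l2' : seq (oedge G)) :
  reduce l1 = reduce l1' -> reduce l2 = reduce l2' ->
  reduce (l1 ++ l2) = reduce (l1' ++ l2').
Proof.
move=> e1 e2.
by rewrite -reduce_catl e1 reduce_catl -reduce_catr e2 reduce_catr.
Qed.

Lemma reduce_cancelr (G : digraph) (l1 l l2 : seq (oedge G)) :
  reduce (l1 ++ l ++ wrev l ++ l2) = reduce (l1 ++ l2).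
Proof.
apply: reduce_congr => //.
by rewrite catA -reduce_catl reduce_wrevr.
Qed.

Lemma reduce_cancell (G : digraph) (l1 l l2 : seq (oedge G)) :
  reduce (l1 ++ wrev l ++ l ++ l2) = reduce (l1 ++ l2).
Proof. by rewrite -{2}(wrevK l) reduce_cancelr. Qed.

Lemma reduce_wrev_reduce (G : digraph) (l : seq (oedge G)) :
  reduce (wrev (reduce l)) = reduce (wrev l).
Proof.
rewrite -[wrev (reduce l)]cats0 -(reduce_cancelr _ l) cats0.
rewrite -reduce_catr -(reduce_catl l) reduce_catr.
by rewrite -[wrev (reduce l) ++ _]cat0s reduce_cancell.
Qed.

Lemma reduced_catl (G : digraph) (l1 l2 : seq (oedge G)) :
  reduced (l1 ++ l2) -> reduced l1.
Proof. by rewrite /reduced => /cat_sorted2[]. Qed.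

(** Since [reduce] folds from the right end, a letter added there needs its own induction; it can
    only cancel against the last letter of [l]. *)
Lemma reduce_rcons (G : digraph) (l : seq (oedge G)) a : reduced l ->
  reduce (rcons l a) = rcons l a \/
  exists2 l', l = rcons l' (oinv a) & reduce (rcons l a) = l'.
Proof.
elim: l => [|b l IH] rl; first by left.
rewrite rcons_cons -[reduce _]/(push b (reduce (rcons l a))).
have [->|[l' e1 ->]] := IH (reduced_cons rl); last first.
  right; exists (b :: l'); rewrite ?e1//.
  move: rl; rewrite e1; case: l' {e1} => //= c l'.
  by rewrite /reduced /= => /andP[/negbTE -> _].
case: l rl {IH} => [_|c l rl] /=; last first.
  by move: rl; rewrite /reduced /= => /andP[/negbTE -> _]; left.
by case: eqP => [->|_]; [right; exists [::]; rewrite // Defs.oinvK | left].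
Qed.

(** Each letter appended on the right removes at most one letter. *)
Lemma reduce_prefix (G : digraph) (X Y : seq (oedge G)) : reduced Y ->
  prefix (take (size Y - size X) Y) (reduce (Y ++ X)).
Proof.
elim: X Y => [|a X IH] Y rY; first by rewrite cats0 reduce_id// prefix_take.
rewrite -cat_rcons -reduce_catl.
have [e|[Y' eY ->]] := reduce_rcons a rY.
  have := IH (rcons Y a); rewrite -{1}e reduce_reduced e => /(_ isT).
  apply: prefix_trans.
  rewrite size_rcons /= -(@takel_cat _ _ Y [:: a]) ?leq_subr//.
  rewrite cats1 -(@take_takel _ _ ((size Y).+1 - size X)) ?prefix_take//.
  by rewrite leq_sub.
move: rY; rewrite eY => rY.
have := IH Y' _; rewrite size_rcons subSS => h.
apply: prefix_trans (h _); last by move: rY; rewrite -cats1 => /reduced_catl.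
by rewrite -cats1 takel_cat ?leq_subr ?prefix_refl.
Qed.

Lemma reduce_head (G : digraph) (a b : oedge G) (X Y : seq (oedge G)) :
  reduced [:: a, b & Y] -> (size X <= size Y)%N ->
  exists Z, reduce ([:: a, b & Y] ++ X) = [:: a, b & Z].
Proof.
move=> rY XY; have := reduce_prefix X rY.
rewrite /= subSn ?subSn ?(leq_trans XY)// /=.
by case/prefixP => Z ->; eexists; reflexivity.
Qed.

(** * Powers of cyclically reduced paths and cyclic reductions *)

Definition word_pow (G : digraph) (d : seq (oedge G)) (k : nat) :
    seq (oedge G) :=
  flatten (nseq k d).

Lemma size_word_pow (G : digraph) (d : seq (oedge G)) k :
  size (word_pow d k) = (k * size d)%N.
Proof. by rewrite /word_pow size_flatten /shape map_nseq sumn_nseq mulnC. Qed.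

Lemma reduced_word_pow (G : digraph) (d : seq (oedge G)) k :
  cyclically_reduced d -> reduced (word_pow d k).
Proof.
case: d => [_|a d cd]; first by elim: k.
rewrite /reduced; apply: (@path_sorted _ _ (last a d)).
move: cd; rewrite /cyclically_reduced /= rcons_path => /andP[pd da].
by elim: k => //= k IH; rewrite cat_path da pd.
Qed.

Lemma cyclically_reduced_wrev (G : digraph) (d : seq (oedge G)) :
  cyclically_reduced (wrev d) = cyclically_reduced d.
Proof.
rewrite /cyclically_reduced /wrev rev_cycle cycle_map.
apply: eq_cycle => a b /=.
by rewrite Defs.oinvK eq_sym.
Qed.

(** The power has at least [k] letters and [X] cancels at most [size X] of them. Two surviving
    letters are all that [level] inspects. *)
Lemma word_pow_head (G : digraph) (a : oedge G) (d X : seq (oedge G)) k :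
  cyclically_reduced (a :: d) -> (size X + 2 <= k)%N ->
  exists b Z, reduce (word_pow (a :: d) k ++ X) = [:: a, b & Z].
Proof.
move=> cd Xk; have rd := reduced_word_pow k cd.
have := size_word_pow (a :: d) k.
have : word_pow (a :: d) k = a :: (d ++ word_pow (a :: d) k.-1).
  by rewrite -(prednK (leq_trans _ Xk)) ?addn2.
case: (d ++ _) => [|b Y] e; rewrite e /= => hs.
  have : (2 <= k * (size d).+1)%N.
    by rewrite (leq_trans _ (leq_pmulr k _))// (leq_trans _ Xk)// leq_addl.
  by rewrite -hs.
rewrite e in rd.
have [] := @reduce_head _ a b X Y rd; last by move=> Z; exists b, Z.
by rewrite -2!ltnS hs -[(size X).+2]addn2 (leq_trans Xk)// leq_pmulr.
Qed.

(** The outer letters are stripped as long as they are mutually inverse. The conjugator [s] is kept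
    because it locates the axis in the cover. *)
Lemma cyclic_reduction_exists (G : digraph) (l : seq (oedge G)) : reduced l ->
  exists s c, [/\ l = s ++ c ++ wrev s, cyclically_reduced c & contracts l c].
Proof.
have [k] := ubnP (size l); elim: k l => // k IH [|a l] sl rl.
  by exists [::], [::]; split => //; constructor.
have [cl|] := boolP (cyclically_reduced (a :: l)).
  by exists [::], (a :: l); split; rewrite ?cats0//; constructor.
rewrite /cyclically_reduced /= rcons_path negb_and => /orP[/negP[]//|].
case/lastP: l rl sl => [_ _|l b rl sl].
  by rewrite negbK => /eqP; case: a => e [].
rewrite last_rcons negbK => /eqP ab.
have eb : b = oinv a by rewrite ab Defs.oinvK.
have rl' : reduced l.
  by move: (reduced_cons rl); rewrite -cats1 => /reduced_catl.
have [|s [c [es cc lc]]] := IH l _ rl'.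
  by move: sl; rewrite /= size_rcons !ltnS => /ltnW.
exists (a :: s), c; split => //.
  by rewrite wrev_cons eb {1}es -!cats1 /= !catA.
(* Rotating the last letter to the front puts the cancelling pair side by side. *)
rewrite -cats1 -cat_cons; apply: contracts_rot.
by rewrite ab /= ; apply: (@contracts_cancel _ [::] b l c).
Qed.

(** * Geodesics in the universal cover and translation along an axis *)

Lemma deck_vertM (G : digraph) (x0 : vert G) (g h : pi1 x0) (v : cvert x0) :
  deck_vert g (deck_vert h v) = deck_vert (g * h)%g v.
Proof. by apply: val_inj; rewrite /= reduce_catr reduce_catl catA. Qed.

Lemma deck_vert1 (G : digraph) (x0 : vert G) (v : cvert x0) :
  deck_vert (1%g : pi1 x0) v = v.
Proof. by apply: val_inj; rewrite /= reduce_id//; case: v => l /= /andP[]. Qed.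

(* The label of the geodesic from [u] to [v] in the universal cover. *)
Definition relpath (G : digraph) (x0 : vert G) (u v : cvert x0) :
    seq (oedge G) :=
  reduce (wrev (cpath u) ++ cpath v).

Lemma relpath_deckr (G : digraph) (x0 : vert G) (g : pi1 x0) (u v : cvert x0) :
  relpath u (deck_vert g v) = reduce (wrev (cpath u) ++ pi1_path g ++ cpath v).
Proof. by rewrite /relpath /= reduce_catr. Qed.

Lemma relpath_deck (G : digraph) (x0 : vert G) (g : pi1 x0) (u v : cvert x0) :
  relpath (deck_vert g u) (deck_vert g v) = relpath u v.
Proof.
rewrite relpath_deckr /= -reduce_catl reduce_wrev_reduce reduce_catl wrev_cat.
by rewrite -catA reduce_cancell.
Qed.

Lemma relpath_nil (G : digraph) (x0 : vert G) (u v : cvert x0) :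
  relpath u v = [::] -> v = u.
Proof.
move=> uv; apply: val_inj => /=.
have red (x : cvert x0) : reduced (cpath x) by case: x => l /= /andP[].
rewrite -(reduce_id (red v)) -[cpath v]cat0s.
rewrite -(reduce_cancelr _ (cpath u)) cat0s.
by rewrite -reduce_catr [reduce (wrev _ ++ _)]uv cats0 reduce_id.
Qed.

Lemma relpath_tgt (G : digraph) (x0 : vert G) (u : cvert x0) (e : cedge x0) :
  relpath u (ctgt e) = reduce (rcons (relpath u (csrc e)) ((val e).2, true)).
Proof. by rewrite /relpath /= -cats1 reduce_catl reduce_catr catA. Qed.

(** The hypothesis says that, up to reduction, [d] labels the way from [u] to its translate by [g];
    each further translation prepends one copy of [d]. *)
Lemma relpath_expg (G : digraph) (x0 : vert G) (g : pi1 x0) (u v : cvert x0)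
    (d : seq (oedge G)) (k : nat) :
  reduce (wrev (cpath u) ++ pi1_path g) = reduce (d ++ wrev (cpath u)) ->
  relpath u (deck_vert (g ^+ k)%g v) =
  reduce (word_pow d k ++ wrev (cpath u) ++ cpath v).
Proof.
move=> ug; elim: k => [|k IH]; first by rewrite expg0 deck_vert1.
rewrite expgS -deck_vertM relpath_deckr catA (reduce_congr ug erefl) -catA.
by rewrite -reduce_catr [reduce (wrev _ ++ _)]IH reduce_catr catA.
Qed.

Lemma reduce_conj_inv (G : digraph) (x0 : vert G) (g : pi1 x0)
    (d z : seq (oedge G)) :
  reduce (z ++ pi1_path g) = reduce (d ++ z) ->
  reduce (z ++ pi1_path (g^-1)%g) = reduce (wrev d ++ z).
Proof.
move=> zg; rewrite /= reduce_catr.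
have e : reduce z = reduce (d ++ z ++ wrev (pi1_path g)).
  rewrite catA (reduce_congr (esym zg) erefl) -catA.
  by rewrite -[X in z ++ X]cats0 -catA reduce_cancelr cats0.
by rewrite (reduce_congr erefl e) (reduce_cancell [::]).
Qed.

(* For a geodesic starting at the initial vertex of [a], labelled by [l]:
   [1] and [2] tell that it crosses [a], [0] and [1] that it ends on [a].
   The values [-1] and [2] beyond the ends of [a] force the intermediate value
   theorem to yield an interior point of [a]. *)
Definition level (R : realType) (G : digraph) (a : oedge G)
    (l : seq (oedge G)) : R :=
  if l is b :: l' then
    if b == a then if l' is [::] then 1 else 2 else -1
  else 0.

(** The inverse power starts with the inverse of the last letter of [a :: d], which differs from [a]
    by cyclic reducedness. *)
Lemma level_word_pow (R : realType) (G : digraph) (a : oedge G)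
    (d X : seq (oedge G)) (k : nat) :
  cyclically_reduced (a :: d) -> (size X + 2 <= k)%N ->
  level R a (reduce (word_pow (a :: d) k ++ X)) = 2 /\
  level R a (reduce (word_pow (wrev (a :: d)) k ++ X)) = -1.
Proof.
move=> cd Xk; have [b [Z ->]] := word_pow_head cd Xk; rewrite /= eqxx.
split=> //; move: (cd); rewrite -cyclically_reduced_wrev.
have : a != oinv (last a d).
  by move: cd; rewrite /cyclically_reduced /= rcons_path => /andP[].
rewrite lastI /wrev map_rcons rev_rcons => ad cd'.
by have [b' [Z' ->]] := word_pow_head cd' Xk; rewrite /= eq_sym (negbTE ad).
Qed.

(** [s] is the direction in which [w] moves along [a]: true if [d] starts with [a], false if its
    inverse does. High powers exhaust the cancellation, which is bounded by the length of [X v];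
    hence [K] depends on [v]. *)
Lemma level_axis (R : realType) (G : digraph) (x0 : vert G) (a : oedge G)
    (w : pi1 x0) (u : cvert x0) (d : seq (oedge G)) :
  reduce (wrev (cpath u) ++ pi1_path w) = reduce (d ++ wrev (cpath u)) ->
  cyclically_reduced d ->
  (exists d', d = a :: d' \/ d = rcons d' (oinv a)) ->
  exists s : bool, forall v, exists K : nat, forall k, (K <= k)%N ->
    level R a (relpath u (deck_vert (w ^+ k)%g v)) = (if s then 2 else -1) /\
    level R a (relpath u (deck_vert (w ^- k)%g v)) = (if s then -1 else 2).
Proof.
move=> ud cd [d' dE]; have ud' := reduce_conj_inv ud.
pose X (v : cvert x0) := wrev (cpath u) ++ cpath v.
have [s [d1 [cd1 d1E]]] : exists (s : bool) d1, cyclically_reduced (a :: d1) /\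
    (if s then d else wrev d) = a :: d1.
  case: dE => e; first by exists true, d'; split => //; rewrite -e.
  have e' : wrev d = a :: wrev d'.
    by rewrite e /wrev map_rcons rev_rcons Defs.oinvK.
  by exists false, (wrev d'); rewrite -e' cyclically_reduced_wrev.
exists s => v; exists (size (X v) + 2)%N => k kX.
rewrite -expVgn (relpath_expg v k ud) (relpath_expg v k ud').
have := level_word_pow R cd1 kX; rewrite -d1E.
by case: s {d1E} => -[]; rewrite ?wrevK.
Qed.

(** * Initial words as prefixes of reduced paths *)

Section InitialWords.
Variables (G : digraph) (x0 : vert G) (T : spanning_tree G).

Let P v := cpath (lift_vert x0 T v).
Let in_tree (a : oedge G) := a.1 \in tree_edge T.

Lemma wfrom_to_lift v : wfrom_to x0 v (P v).
Proof. by have := cvert_path (lift_vert x0 T v); rewrite cend_lift_vert. Qed.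

Lemma all_lift v : all in_tree (P v).
Proof. by have /andP[] := xchooseP (tree_lift_subproof x0 T v). Qed.

Lemma all_wrev (l : seq (oedge G)) : all in_tree (wrev l) = all in_tree l.
Proof. by rewrite /wrev all_rev all_map. Qed.

Lemma lift_base : P x0 = [::].
Proof.
apply: (tree_acyclic (wfrom_to_lift x0) _ (all_lift x0)).
by rewrite /P; case: (lift_vert _ _ _) => l /= /andP[].
Qed.

Lemma wfrom_to_letter (a : oedge G) : wfrom_to (ostart a) (oend a) [:: a].
Proof. by rewrite /wfrom_to /= !eqxx. Qed.

Lemma wfrom_to_fundamental (a : oedge G) :
  wfrom_to x0 x0 (P (ostart a) ++ [:: a] ++ wrev (P (oend a))).
Proof.
apply: wfrom_to_cat (wfrom_to_lift _) _.
by apply: wfrom_to_cat (wfrom_to_letter _) (wfrom_to_rev (wfrom_to_lift _)).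
Qed.

Lemma fundamental_tree (a : oedge G) : in_tree a ->
  reduce (P (ostart a) ++ [:: a] ++ wrev (P (oend a))) = [::].
Proof.
move=> Ta; apply: (tree_acyclic (wfrom_to_reduce (wfrom_to_fundamental a))).
  exact: reduce_reduced.
have : all in_tree (P (ostart a) ++ [:: a] ++ wrev (P (oend a))).
  by rewrite !all_cat all_seq1 all_wrev !all_lift Ta.
exact: all_reduce.
Qed.

Lemma pi1_path_letter (a : oedge G) :
  pi1_path (if a.2 then theta x0 T a.1 else (theta x0 T a.1)^-1)%g =
  reduce (P (ostart a) ++ [:: a] ++ wrev (P (oend a))).
Proof.
case: a => e [] //=; rewrite reduce_wrev_reduce wrev_cat wrev_cons wrevK.
by rewrite -cats1 -catA.
Qed.

(** Telescoping: replace each letter by its fundamental loop through the tree. Neighbouring tree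
    paths cancel, and the loops of tree letters are trivial. *)
Lemma pi1_path_word_eval (u v : vert G) (l : seq (oedge G)) : wfrom_to u v l ->
  pi1_path (word_eval x0 T [seq a <- l | ~~ in_tree a]) =
  reduce (P u ++ l ++ wrev (P v)).
Proof.
elim: l u => [|a l IH] u.
  by rewrite /wfrom_to /= => /eqP <-; rewrite reduce_wrevr /word_eval big_nil.
rewrite /wfrom_to /= -andbA => /andP[/eqP <- /IH {}IH].
have -> : reduce (P (ostart a) ++ a :: l ++ wrev (P v)) =
    reduce (reduce (P (ostart a) ++ [:: a] ++ wrev (P (oend a))) ++
            reduce (P (oend a) ++ l ++ wrev (P v))).
  rewrite reduce_catl reduce_catr -!catA catA.
  by rewrite (reduce_cancell (P (ostart a) ++ [:: a])) -catA.
rewrite -IH; case: ifPn => [Ta|]; last first.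
  by rewrite negbK => /fundamental_tree ->; rewrite reduce_id ?pi1_reduced.
by rewrite -pi1_path_letter /word_eval big_cons.
Qed.

Lemma filter_eq_cons (X : Type) (p : pred X) (l m : seq X) b :
  [seq x <- l | p x] = b :: m ->
  exists t l', l = t ++ b :: l' /\ all (predC p) t.
Proof.
elim: l => //= x l IH; case: ifPn => [_ [-> _]|px /IH [t [l' [-> pt]]]].
  by exists [::], l.
by exists (x :: t), l'; rewrite /= px.
Qed.

(** Letters made adjacent by the erasure are joined in [l] by a reduced tree path. If they were
    mutually inverse, this path would be closed, hence empty, and [l] would backtrack. *)
Lemma reduced_nontree (u : vert G) (l : seq (oedge G)) :
  walk u l -> reduced l -> reduced [seq a <- l | ~~ in_tree a].
Proof.
elim: l u => //= a l IH u /andP[_ wl] rl.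
have := IH _ wl (reduced_cons rl); case: ifP => // Ta.
case E : [seq _ <- l | _] => [//|b m] rm.
rewrite /reduced /=; apply/andP; split => //.
have [t [l' [el Tt]]] := filter_eq_cons E.
apply/eqP => ab; move: wl rl; rewrite el walk_cat /= => /and3P[wt /eqP bt _] rl.
have rt := reduced_cons rl.
have t0 : t = [::].
  apply: (@tree_acyclic _ T (oend a) t).
  - by rewrite /wfrom_to wt -bt ab ostart_inv eqxx.
  - exact: reduced_catl rt.
  - by apply: sub_all Tt => x /=; rewrite negbK.
by move: rl; rewrite t0 /reduced /= ab eqxx.
Qed.

End InitialWords.

(** The letters of [l1] outside the tree spell [g], whose loop is [l1] followed by the return
    through the tree; the path of [lift_vert] undoes that return. *)
Lemma initial_word_prefix (G : digraph) (x0 : vert G) (T : spanning_tree G)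
    (w : pi1 x0) (v : vert G) (l1 l2 : seq (oedge G)) :
  pi1_path w = l1 ++ l2 -> wend x0 l1 = v ->
  exists g, initial_word T g w /\ cpath (deck_vert g (lift_vert x0 T v)) = l1.
Proof.
move=> wE l1v; have := pi1_loop w; have rw := pi1_reduced w.
rewrite wE in rw; rewrite wE => hw.
have w1 : wfrom_to x0 v l1.
  by move: hw; rewrite /wfrom_to walk_cat l1v eqxx => /andP[/andP[->]].
pose tw l : seq (oedge G) := [seq a <- l | a.1 \notin tree_edge T].
exists (word_eval x0 T (tw l1)); split; last first.
  rewrite /= (pi1_path_word_eval x0 T w1) reduce_catl lift_base -!catA cat0s.
  rewrite -[wrev _ ++ _]cats0 -catA reduce_cancell cats0 reduce_id//.
  exact: reduced_catl rw.
exists (tw l1), (tw l2); split => //; rewrite /tw -filter_cat; split.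
- exact: filter_all.
- by have /andP[wl _] := hw; exact: reduced_nontree wl rw.
- apply: val_inj; rewrite /= (pi1_path_word_eval x0 T hw) lift_base cats0 wE.
  exact: reduce_id.
Qed.

(** Write [w] as a conjugate of its cyclic reduction [c] and cut [c] at an occurrence of [E]: [u] is
    the vertex of the axis at the cut, and [d] is [c] read from there. *)
Lemma belongs_axis (G : digraph) (x0 : vert G) (T : spanning_tree G)
    (E : edge G) (w : pi1 x0) : belongs E w ->
  exists g d, let u := deck_vert g (lift_vert x0 T (src E)) in
    [/\ initial_word T g w, cyclically_reduced d,
      reduce (wrev (cpath u) ++ pi1_path w) = reduce (d ++ wrev (cpath u)) &
      exists d', d = (E, true) :: d' \/ d = rcons d' (E, false)].
Proof.
move=> Ew; have [s [c [wE cc wc]]] := cyclic_reduction_exists (pi1_reduced w).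
have /Ew Ec : cyclic_reduction w c.
  exists (pi1_path w), (pi1_loop w); split => //.
  by apply: val_inj; rewrite /= reduce_id ?pi1_reduced.
(* The cut comes before a forward [E] but after a reversed one, so that it lies at the initial
   vertex of [E] in both cases. *)
have [c1 [c2 [cE cE12]]] : exists c1 c2, c = c1 ++ c2 /\
    ((exists l, c2 = (E, true) :: l) \/ exists l, c1 = rcons l (E, false)).
  case/orP: Ec => /splitPr[l1 l2].
    by exists l1, ((E, true) :: l2); split => //; left; exists l2.
  exists (rcons l1 (E, false)), l2; rewrite cat_rcons.
  by split => //; right; exists l1.
have w12 : pi1_path w = (s ++ c1) ++ (c2 ++ wrev s) by rewrite wE cE -!catA.
have endE : wend x0 (s ++ c1) = src E.
  have := pi1_loop w; rewrite w12 /wfrom_to walk_cat => /andP[/andP[_ h] _].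
  case: cE12 => -[l e]; last by rewrite e wend_cat -cats1 wend_cat.
  by move: h; rewrite e /= => /andP[/eqP].
have [g [gw gE]] := initial_word_prefix T w12 endE.
exists g, (c2 ++ c1); rewrite /= in gE *; rewrite gE; split => //.
- by move: cc; rewrite cE /cyclically_reduced cycle_catC.
- rewrite w12 wrev_cat -!catA reduce_cancelr (reduce_cancell (wrev c1)).
  exact: (reduce_cancell [::]).
- case: cE12 => -[l ->]; first by exists (l ++ c1); left.
  by exists (c2 ++ l); right; rewrite rcons_cat.
Qed.

(** The fundamental loop of a tree edge is trivial. The hypothesis that [E] is in the tree enters
    the theorem here. *)
Lemma ctgt_lift_edge (G : digraph) (x0 : vert G) (T : spanning_tree G)
    (E : edge G) : E \in tree_edge T ->
  ctgt (lift_edge x0 T E) = lift_vert x0 T (tgt E).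
Proof.
move=> ET; apply: val_inj => /=.
have rt : reduced (cpath (lift_vert x0 T (tgt E))).
  by case: (lift_vert _ _ _) => l /= /andP[].
have := @fundamental_tree G x0 T (E, true) ET; rewrite /ostart /oend /=.
set Ps := cpath _; set Pt := cpath _ => h.
rewrite -[Ps ++ _]cats0 -(reduce_cancell _ Pt) cats0 catA -reduce_catl.
by rewrite -catA h cat0s reduce_id.
Qed.

(** * Projection of the tree onto an edge, and the intermediate value argument *)

Section Topology.
Variable R : realType.

Lemma continuous_charmap (G : digraph) (e : edge G) :
  continuous (@charmap R G e).
Proof. by apply/continuousP => A oA; exact: (oA e). Qed.

Lemma charmap_in (G : digraph) (e : edge G) (t : {t : R | 0 < t < 1}) :
  charmap e (val t) = GEdge e t.
Proof. by rewrite /charmap valK. Qed.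

Lemma charmap0 (G : digraph) (e : edge G) : charmap e (0 : R) = GVert (src e).
Proof. by rewrite /charmap insubN ?lexx// ltxx. Qed.

Lemma charmap1 (G : digraph) (e : edge G) : charmap e (1 : R) = GVert (tgt e).
Proof. by rewrite /charmap insubN ?ltxx ?andbF// ler10. Qed.

(** With [L] the level relative to an edge, this replaces the projection of the tree onto that edge;
    on the edge itself it is the parameter. *)
Definition affine_ext (G : digraph) (L : vert G -> R) (y : gpoint R G) : R :=
  match y with
  | GVert v => L v
  | GEdge e t => (1 - val t) * L (src e) + val t * L (tgt e)
  end.

Lemma continuous_affine_ext (G : digraph) (L : vert G -> R) :
  continuous (affine_ext L).
Proof.
apply/continuousP => A oA.
suff h : gopen (affine_ext L @^-1` A) by exact: h.
move=> e; rewrite -comp_preimage.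
(* The retraction onto [0, 1] that is implicit in [charmap]; it gives one continuous formula on the
   whole line. *)
pose cl (t : R) := Order.max 0 (Order.min t 1).
have -> : affine_ext L \o charmap e =
    fun t => (1 - cl t) * L (src e) + cl t * L (tgt e).
  apply/funext => t; rewrite /= /charmap /cl.
  case: insubP => [t' ht <-|] /=.
    case/andP: (valP t') => t0 t1.
    by rewrite min_l ?max_r// ltW.
  rewrite negb_and -!leNgt; case: (leP t 0) => /= [t0 _|t0 t1].
    by rewrite max_l ?subr0 ?mul1r ?mul0r ?addr0// ge_min t0.
  by rewrite min_r// max_r// subrr mul0r mul1r add0r.
apply: open_comp oA => t _.
have ccl : {for t, continuous cl}.
  apply: (@continuous_max R R (cst 0) (idfun \min cst 1)); first exact: cvg_cst.
  by apply: continuous_min; [exact: cvg_id | exact: cvg_cst].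
apply: cvgD; apply: cvgM => //; try exact: cvg_cst.
by apply: cvgB => //; exact: cvg_cst.
Qed.

(** Along [e] the geodesic changes only at its far end, so its first letter can change only if it is
    empty at one end of [e]. *)
Lemma level_edge (G : digraph) (x0 : vert G) (e0 e : cedge x0) :
  let L v := level R ((val e0).2, true) (relpath (csrc e0) v) in
  [\/ [/\ e = e0, L (csrc e) = 0 & L (ctgt e) = 1],
      L (csrc e) <= 0 /\ L (ctgt e) <= 0 | 1 <= L (csrc e) /\ 1 <= L (ctgt e)].
Proof.
set a := (_, true); move=> L; rewrite /L.
have m1 : -1 <= 0 :> R by rewrite lerN10.
have m2 : 1 <= 2 :> R by rewrite ler1n.
have re : reduced (relpath (csrc e0) (csrc e)) by exact: reduce_reduced.
rewrite relpath_tgt; have := reduce_rcons ((val e).2, true) re.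
case El : (relpath (csrc e0) (csrc e)) {re} => [|b l].
  case=> [->|[[|? ?] //]] /=; case: ifPn => [/eqP e2|_]; last by constructor 2.
  constructor 1; split => //; apply: val_inj.
  rewrite (surjective_pairing (val e)) (surjective_pairing (val e0)).
  by congr (_, _); [exact: relpath_nil El | case: e2].
case=> [->|[l' e1 ->]].
  rewrite /=; case: (b == a); last by constructor 2.
  by constructor 3; split; case: l {El} => //= *.
(* If the geodesic shrinks to the empty one, its only letter was a reversed edge, which is not
   [a]. *)
case: l' e1 => [[-> ->]|c l' [-> ->]] /=.
  by constructor 2; split => //; case: eqP.
case: (c == a); last by constructor 2; case: l'.
by constructor 3; case: l'.
Qed.

(** Vertices have level -1, 0, 1 or 2, and on edges other than [e0] the values stay outside the open
    interval from 0 to 1. *)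
Lemma affine_level (G : digraph) (x0 : vert G) (e0 : cedge x0)
    (y : gpoint R (ucover x0)) (t : {t : R | 0 < t < 1}) :
  affine_ext (G := ucover x0)
    (fun v => level R ((val e0).2, true) (relpath (csrc e0) v)) y = val t ->
  y = @GEdge R (ucover x0) e0 t.
Proof.
case: t => t t01; have /andP[t0 t1] := t01; rewrite /=; case: y => [v|e s] /=.
  rewrite /level => ht; exfalso; move: ht.
  case: relpath => [|b [|c l]]; first lra;
    by case: (b == _); lra.
case: s => s s01; have /andP[s0 s1] := s01; rewrite /=; have := level_edge e0 e.
rewrite /=; set L0 := level _ _ _; set L1 := level _ _ (relpath _ (ctgt e)).
case=> [[ee -> ->]|[L00 L10]|[L01 L11]].
- by rewrite mulr0 mulr1 add0r => st; rewrite ee; congr GEdge; exact: val_inj.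
- by move=> st; exfalso; nra.
- by move=> st; exfalso; nra.
Qed.

(** A zero of [F] is a parameter equal to the level of its image. [F] changes sign on [0, 1] and is
    nonzero at both ends. *)
Lemma edge_crossing (G : digraph) (x0 : vert G) (e0 : cedge x0)
    (h : R -> gpoint R (ucover x0)) (v0 v1 : cvert x0) (s : bool) :
  let L v := level R ((val e0).2, true) (relpath (csrc e0) v) in
  continuous h -> h 0 = @GVert R (ucover x0) v0 ->
  h 1 = @GVert R (ucover x0) v1 ->
  L v0 = (if s then -1 else 2) -> L v1 = (if s then 2 else -1) ->
  exists t : {t : R | 0 < t < 1}, h (val t) = @GEdge R (ucover x0) e0 t.
Proof.
move=> L ch h0 h1 L0 L1.
pose F t := affine_ext (G := ucover x0) L (h t) - t.
have F0 : F 0 = if s then -1 else 2 by rewrite /F h0 subr0.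
have F1 : F 1 = if s then 1 else - 2.
  by rewrite /F h1 /= L1; case: s {L0 L1 F0}; lra.
have cF : continuous F.
  move=> t; apply: (@continuousB _ _ _ (affine_ext (G := ucover x0) L \o h)).
    exact: continuous_comp (ch t) (@continuous_affine_ext _ _ _).
  exact: cvg_id.
have [||t] := @IVT R F 0 1 0 ler01.
- exact: continuous_subspaceT.
- rewrite F0 F1 ge_min le_max.
  by case: s {F0 F1 L0 L1}; apply/andP; split; apply/orP; lra.
rewrite in_itv /= => /andP[t0 t1] Ft.
have ht : 0 < t < 1.
  rewrite !lt_neqAle t0 t1 !andbT; apply/andP; split; apply/eqP => e.
    by move: F0; rewrite e Ft; case: s {F1 L0 L1}; lra.
  by move: F1; rewrite -e Ft; case: s {F0 L0 L1}; lra.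
exists (exist _ t ht); apply: affine_level; apply/eqP.
by rewrite -subr_eq0; apply/eqP.
Qed.

End Topology.

(** * Integer powers and iterates of the lift *)

Lemma expgzS (gT : groupType) (g : gT) (k : int) :
  expgz g (k + 1) = (expgz g k * g)%g.
Proof.
case: k => k; first by rewrite -PoszD addn1 /= expgSr.
case: k => [|k]; first by rewrite /= mulVg.
have -> : Negz k.+1 + 1 = Negz k by rewrite !NegzE -addn1 PoszD; lra.
by rewrite /= [(g ^+ k.+2)%g]expgS invgM mulgVK.
Qed.

Lemma expgzD (gT : groupType) (g : gT) (i j : int) :
  expgz g (i + j) = (expgz g i * expgz g j)%g.
Proof.
have nat_case i' (k : nat) : expgz g (i' + k%:Z) = (expgz g i' * g ^+ k)%g.
  elim: k => [|k IH]; first by rewrite addr0 expg0 mulg1.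
  by rewrite -addn1 PoszD addrA expgzS IH addn1 expgSr mulgA.
case: j => k; first exact: nat_case.
have := nat_case (i + Negz k) k.+1; rewrite {1}NegzE subrK => ->.
by rewrite /= mulgK.
Qed.

Lemma expgzN (gT : groupType) (g : gT) (k : nat) :
  expgz g (- k%:Z) = (g ^- k)%g.
Proof. by case: k => [|k]; rewrite ?oppr0 /= ?expg0 ?invg1. Qed.

Lemma expgz_expg (gT : groupType) (g : gT) (i : int) (k : nat) :
  (expgz g i ^+ k)%g = expgz g (i * k%:Z).
Proof.
elim: k => [|k IH]; first by rewrite mulr0.
by rewrite expgSr IH -addn1 PoszD mulrDr mulr1 expgzD.
Qed.

Lemma continuous_iter (X : topologicalType) (F : X -> X) (k : nat) :
  continuous F -> continuous (iter k F).
Proof.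
move=> cF; elim: k => [|k IH] x; first exact: cvg_id.
by apply: continuous_comp; [exact: IH | exact: cF].
Qed.

Lemma iter_deck (R : realType) (G : digraph) (x0 : vert G)
    (F : gpoint R (ucover x0) -> gpoint R (ucover x0)) :
  (forall g y, F (deck g y) = deck g (F y)) ->
  forall k g y, iter k F (deck g y) = deck g (iter k F y).
Proof. by move=> eqF; elim=> //= k IH g y; rewrite IH eqF. Qed.

Lemma iter_deck_vert (R : realType) (G : digraph) (x0 : vert G)
    (F : gpoint R (ucover x0) -> gpoint R (ucover x0)) (g : pi1 x0)
    (v : cvert x0) :
  (forall h y, F (deck h y) = deck h (F y)) ->
  F (@GVert R (ucover x0) v) = @GVert R (ucover x0) (deck_vert g v) ->
  forall k, iter k F (@GVert R (ucover x0) v) =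
            @GVert R (ucover x0) (deck_vert (g ^+ k)%g v).
Proof.
move=> eqF Fv; elim=> [|k IH]; first by rewrite expg0 deck_vert1.
rewrite iterS IH.
rewrite -[GVert _]/(deck (g ^+ k)%g (@GVert R (ucover x0) v)) eqF Fv /=.
by rewrite deck_vertM expgSr.
Qed.

(** Clears denominators: [n * denq rho] iterations translate by [w0 ^+ denq rho], which is the power
    [numq rho * n] of [w]. *)
Lemma rotation_vertex (R : realType) (G : digraph) (x0 : vert G)
    (T : spanning_tree G) (f : gpoint R G -> gpoint R G)
    (ft : gpoint R (ucover x0) -> gpoint R (ucover x0)) (v : vert G)
    (w : pi1 x0) (rho : rat) :
  (forall g y, ft (deck g y) = deck g (ft y)) ->
  rotation_eq T f ft (GVert v) w rho ->
  exists (N : nat) (K : int), [/\ (0 < N)%N, rho = K%:Q / N%:Q &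
    forall k, iter (k * N) ft (@GVert R (ucover x0) (lift_vert x0 T v)) =
      @GVert R (ucover x0) (deck_vert (expgz w (K * k%:Z)) (lift_vert x0 T v))].
Proof.
move=> eqf [n [w0 [[n0 _] ftn w0E]]].
have numn : numq (n%:Q)^-1 = 1.
  rewrite -div1r -[1 / _]/(1%:~R / _).
  by rewrite coprimeq_num ?coprime1n// gtr0_sg ?mul1r// ltz_nat.
have denn : denq (n%:Q)^-1 = n.
  rewrite -div1r -[1 / _]/(1%:~R / _).
  by rewrite coprimeq_den ?coprime1n//; case: (n) n0.
have d0 := denq_gt0 rho.
have dE : denq rho = (absz (denq rho))%:Z by rewrite gtz0_abs.
exists (absz (denq rho) * n)%N, (numq rho * n); split.
- by rewrite muln_gt0 n0 absz_gt0 gt_eqF.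
- rewrite PoszM -dE !intrM -mulf_div divff ?mulr1 ?divq_num_den//.
  by rewrite intr_eq0 -lt0n.
move=> k; rewrite mulnA iterM.
rewrite (@iter_deck_vert _ _ _ _ w0) //; last exact: iter_deck.
congr (@GVert R (ucover x0) (deck_vert _ _)).
move: w0E; rewrite /qpow_eq numn denn mul1r dE /= => w0E.
by rewrite mulnC expgnA w0E expgz_expg.
Qed.

(** After cross multiplication the two integers differ by at least 1. *)
Lemma ratio_gap (K1 K2 : int) (N1 N2 M : nat) :
  (0 < N1)%N -> (0 < N2)%N -> K1%:Q / N1%:Q < K2%:Q / N2%:Q ->
  M%:Z <= K2 * N1 * M - K1 * N2 * M.
Proof.
move=> N10 N20; rewrite ltr_pdivrMr ?ltr0z// mulrAC ltr_pdivlMr ?ltr0z//.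
rewrite -!intrM ltr_int -lezD1 => h.
by rewrite -mulrBl ler_peMl// lerBrDl.
Qed.

(** * Existence of the periodic point *)

Theorem theorem28 (R : realType) (G : digraph) (x0 : vert G)
    (finV : finite_set [set: vert G]) (finE : finite_set [set: edge G])
    (connG : connected_graph G) (noloop : forall e : edge G, src e <> tgt e)
    (T : spanning_tree G)
    (f : gpoint R G -> gpoint R G) (contf : continuous f)
    (permf : permutes_vertices f) (homf : homotopic R f idfun)
    (ft : gpoint R (ucover x0) -> gpoint R (ucover x0))
    (liftf : equivariant_lift f ft)
    (E : edge G) (ET : E \in tree_edge T) (m n : nat)
    (perV1 : periodic_point f m (GVert (src E)))
    (perV2 : periodic_point f n (GVert (tgt E)))
    (w : pi1 x0) (Ew : belongs E w) (k1 k2 : int)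
    (rhoV1 : rotation_eq T f ft (GVert (src E)) w (k1%:Q / m%:Q))
    (rhoV2 : rotation_eq T f ft (GVert (tgt E)) w (k2%:Q / n%:Q))
    (r : rat)
    (hr : k1%:Q / m%:Q < r < k2%:Q / n%:Q \/ k2%:Q / n%:Q < r < k1%:Q / m%:Q) :
  exists p q : int, [/\ 0 < q, p%:Q / q%:Q = r &
    exists x : gpoint R G, exists g : pi1 x0,
      [/\ closed_edge E x, exists N, periodic_point f N x,
          initial_word T g w
        & rotation_eq T f ft x (expgz w p * g)%g (q%:Q)^-1]].
Proof.
have [contft projft eqft] := liftf.
have [N1 [K1 [N10 rho1 ft1]]] := rotation_vertex eqft rhoV1.
have [N2 [K2 [N20 rho2 ft2]]] := rotation_vertex eqft rhoV2.
have [g [d]] := belongs_axis T Ew; set u := deck_vert g _ => -[gw cd ud dE].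
have [s lev] := level_axis R ud cd dE.
have [M1 lev1] := lev (lift_vert x0 T (src E)).
have [M2 lev2] := lev (lift_vert x0 T (tgt E)).
pose D := absz (denq r).
have D0 : (0 < D)%N by rewrite absz_gt0 gt_eqF ?denq_gt0.
have rE : r = (numq r)%:Q / D%:Q by rewrite /D gtz0_abs ?denq_gt0 ?divq_num_den.
pose M := (M1 + M2).+1.
(* [p], [a] and [b] are [N] times [r] and the two rotation exponents. The factor [M] moves [a] and
   [b] away from [p] by more than both thresholds. *)
pose N := (M * (D * (N1 * N2)))%N.
have N0 : (0 < N)%N by rewrite !muln_gt0 D0 N10 N20.
pose p := numq r * (N1 * N2 * M)%N%:Z.
pose a := K1 * (N2 * D * M)%N%:Z.
pose b := K2 * (N1 * D * M)%N%:Z.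
have fta : iter N ft (@GVert R (ucover x0) (lift_vert x0 T (src E))) =
    @GVert R (ucover x0) (deck_vert (expgz w a) (lift_vert x0 T (src E))).
  by rewrite -ft1; congr iter; rewrite /N; nia.
have ftb : iter N ft (@GVert R (ucover x0) (lift_vert x0 T (tgt E))) =
    @GVert R (ucover x0) (deck_vert (expgz w b) (lift_vert x0 T (tgt E))).
  by rewrite -ft2; congr iter; rewrite /N; nia.
pose delta := (expgz w p * g)%g.
pose e0 := deck_edge delta (lift_edge x0 T E).
have src_e0 : csrc e0 = deck_vert (expgz w p) u by rewrite deck_vertM.
(* Translating back by the power [p] of [w] moves [e0] to the lift of [E] at [u], on the axis, so
   only [i - p] matters. *)
have level_e0 i v : relpath (csrc e0) (deck_vert (expgz w i) v) =
    relpath u (deck_vert (expgz w (i - p)) v).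
  rewrite src_e0 -[RHS](relpath_deck (expgz w p)) deck_vertM -expgzD.
  by rewrite addrC subrK.
pose L i v := level R (E, true) (relpath (csrc e0) (deck_vert (expgz w i) v)).
have [s' [la lb]] : exists s' : bool,
    L a (lift_vert x0 T (src E)) = (if s' then -1 else 2) /\
    L b (lift_vert x0 T (tgt E)) = (if s' then 2 else -1).
  rewrite /L !level_e0.
  have gap i j (N' : nat) : (0 < N')%N -> (M * N')%N%:Z <= i - j ->
      exists k : nat, [/\ i - j = k, j - i = - k%:Z, (M1 <= k)%N & (M2 <= k)%N].
    by move=> N'0 ij; exists (absz (i - j)); split; move: ij; rewrite /M; nia.
  (* Exchanging the order of the two ratios reverses the crossing, hence [s] in one case and [~~ s]
     in the other. *)
  case: hr => /andP[]; rewrite rho1 rho2 => h1 h2; rewrite rE in h1 h2.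
  - have [|k [_ -> kM1 kM2]] := gap p a N2 N20.
      by apply: le_trans (ratio_gap (M * N2)%N N10 D0 h1) _; rewrite /p /a; nia.
    have [|l [-> _ lM1 lM2]] := gap b p N1 N10.
      by apply: le_trans (ratio_gap (M * N1)%N D0 N20 h2) _; rewrite /p /b; nia.
    by exists s; rewrite expgzN (lev1 k kM1).2 (lev2 l lM2).1.
  - have [|k [_ -> kM1 kM2]] := gap p b N1 N10.
      by apply: le_trans (ratio_gap (M * N1)%N N20 D0 h1) _; rewrite /p /b; nia.
    have [|l [-> _ lM1 lM2]] := gap a p N2 N20.
      by apply: le_trans (ratio_gap (M * N2)%N D0 N10 h2) _; rewrite /p /a; nia.
    by exists (~~ s); rewrite expgzN (lev1 l lM1).1 (lev2 k kM2).2; case: (s).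
pose Et : edge (ucover x0) := lift_edge x0 T E.
have ch : continuous (iter N ft \o charmap Et).
  move=> t; apply: continuous_comp; first exact: continuous_charmap.
  exact: continuous_iter.
have [||t ht] := @edge_crossing R G x0 e0 _ _ _ s' ch _ _ la lb.
- by rewrite /= charmap0 /= fta.
- by rewrite /= charmap1 /= ctgt_lift_edge// ftb.
have {}ht : iter N ft (GEdge Et t) = @GEdge R (ucover x0) e0 t.
  by rewrite -ht /= charmap_in.
(* [e0] lies over [E] and the parameter is unchanged, so the point closes up after projection. *)
have per : periodic_point f N (GEdge E t).
  split=> //.
  have projN y : cover_proj (iter N ft y) = iter N f (cover_proj y).
    by elim: (N) => //= k IH; rewrite projft IH.
  rewrite -[GEdge E t]/(cover_proj (GEdge Et t : gpoint R (ucover x0))).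
  by rewrite -projN ht.
exists p, N; split => //.
  rewrite [RHS]rE /p /N !PoszM !intrM.
  by field; rewrite !pnatr_eq0 -!lt0n N10 N20 D0.
exists (GEdge E t), g; split => //; last by exists N, delta.
- exists (val t); last exact: charmap_in.
  by case/andP: (valP t) => t0 t1; rewrite /= in_itv /= !ltW.
- by exists N.
Qed.
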